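(* Let $r\geq 2$. There exists $c=c(r)>0$ such that the following holds. Let $H$ be an $r$-uniform hypergraph on $n$ vertices of average degree $d$, where $1\leq d\leq \frac{1}{2}\binom{n-1}{r-1}$. Then $\mathrm{disc}(H)\geq c\sqrt{d}\,n$.
   Context: For an $r$-uniform hypergraph $H$ on $n$ vertices with edge density $p=|E(H)|/\binom{n}{r}$ and $U\subset V(H)$, let $e(U)$ be the number of edges of $H$ contained in $U$ and $\mathrm{disc}(U)=e(U)-p\binom{|U|}{r}$. The discrepancy is $\mathrm{disc}(H)=\max_{U\subset V(H)}|\mathrm{disc}(U)|$. The average degree is $d=r|E(H)|/n$. *)

(* Defs.v *)
From mathcomp Require Import all_boot all_order all_algebra.
From mathcomp Require Import reals.
Set Implicit Arguments. Unset Strict Implicit. Unset Printing Implicit Defensive.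
Import Order.TTheory GRing.Theory Num.Theory.
Local Open Scope ring_scope.

Definition uniform (T : finType) (r : nat) (E : {set {set T}}) : bool :=
  [forall e in E, #|e| == r].

Section Disc.
Variables (R : realType) (T : finType) (r : nat) (E : {set {set T}}).

Definition density : R := (#|E|%:R) / ('C(#|T|, r))%:R.

Definition e_in (U : {set T}) : nat := #|[set e in E | e \subset U]|.

Definition discU (U : {set T}) : R :=
  (e_in U)%:R - density * ('C(#|U|, r))%:R.

Definition disc : R := \big[Num.max/0]_(U : {set T}) `|discU U|.

Definition avg_degree : R := (r * #|E|)%:R / (#|T|)%:R.
End Disc.

(* Main.v *)
Require Import Defs.
From mathcomp Require Import all_boot all_order all_algebra.
From mathcomp Require Import reals ring lra.
Import Order.TTheory GRing.Theory Num.Theory.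
Local Open Scope ring_scope.

Set Implicit Arguments.
Unset Strict Implicit.
Unset Printing Implicit Defensive.

(** Let [w S = [S in E] - p] on [r]-sets and let [D] be the multilinear form with
    coefficients [w]; the discrepancy is the maximum of [|D|] over the 0/1 points.
    As [D] is multi-affine and homogeneous of degree [r], polynomial
    interpolation along lines bounds [D] on [[-1, 1]^V] and then, moving in the
    direction of the signs of the partial derivatives, bounds
    [\sum_v |D_v(x)|] by [C(r) disc] for every [x] in [[-1, 1]^V].
    At [x = 1] this controls [\sum_v |deg v - d|].  For random signs [x],
    Bonami's inequality shows that [|D_v(x)|] is on average at least
    [c(r) sqrt(Q_v)], where [Q_v = \sum_(S : v in S) w(S)^2 = (1 - 2p) deg v + p d].
    For each vertex one of [|deg v - d|], [Q_v] is at least [d / 2], so each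
    vertex contributes a constant times [sqrt d]. *)

(** * Polynomial interpolation on [0, 1] *)

Lemma poly_coef_bound (R : realFieldType) (r : nat) :
  exists2 C : R, 0 <= C &
    forall (p : {poly R}) (M : R), (size p <= r.+1)%N ->
      (forall t, 0 <= t <= 1 -> `|p.[t]| <= M) -> forall i, `|p`_i| <= C * M.
Proof.
(* The [r.+1] distinct nodes [j / r.+1] lie in [0, 1]. Inverting their Vandermonde matrix writes
   each coefficient as a fixed combination of the values there, so the sum of the absolute values of
   all entries of the inverse serves as [C]. *)
pose t : 'rV[R]_r.+1 := \row_j (j%:R / r.+1%:R).
have t01 j : 0 <= t 0 j <= 1.
  by rewrite mxE divr_ge0 //= ler_pdivrMr ?ltr0n // mul1r ler_nat ltnW.
pose V := Vandermonde r.+1 t.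
have Vu : V \in unitmx.
  rewrite unitmxE unitfE det_Vandermonde; apply/prodf_neq0 => i _.
  apply/prodf_neq0 => j lt_ij; rewrite subr_eq0 !mxE.
  rewrite (inj_eq (mulIf _)) ?invr_eq0 ?pnatr_eq0 //.
  by rewrite eqr_nat gtn_eqF.
pose W := invmx V.
exists (\sum_i \sum_j `|W j i|) => [|p M sz_p pM k].
  by apply: sumr_ge0 => i _; apply: sumr_ge0.
have M0 : 0 <= M by apply: le_trans (pM 0 _); rewrite ?lexx ?ler01.
have [k_big|lt_k] := leqP r.+1 k.
  rewrite nth_default ?normr0 ?(leq_trans sz_p) //.
  by rewrite mulr_ge0 // sumr_ge0 // => i _; apply: sumr_ge0.
pose i := Ordinal lt_k.
have -> : p`_k = \sum_j W j i * p.[t 0 j].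
  have -> : p`_k = \sum_(l < r.+1) p`_l * (V *m W) l i.
    rewrite mulmxV // (bigD1 i) //= big1 => [|l ne_li].
      by rewrite mxE eqxx mulr1 addr0.
    by rewrite mxE (negbTE ne_li) mulr0.
  under eq_bigr do rewrite mxE mulr_sumr.
  rewrite exchange_big; apply: eq_bigr => j _ /=.
  rewrite (horner_coef_wide _ sz_p) mulr_sumr; apply: eq_bigr => l _.
  by rewrite /V /Vandermonde [in X in _ * (X * _)]mxE; ring.
apply: le_trans (ler_norm_sum _ _ _) _.
rewrite [X in X * M](bigD1 i) //= mulrDl -[leLHS]addr0 lerD //; last first.
  by rewrite mulr_ge0 // sumr_ge0 // => l _; apply: sumr_ge0.
rewrite mulr_suml; apply: ler_sum => j _; rewrite normrM ler_wpM2l //.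
exact: pM.
Qed.

Lemma deriv_prod_set (R : comNzRingType) (T : finType) (S : {set T})
    (P : T -> {poly R}) :
  (\prod_(i in S) P i)^`() =
    \sum_(v in S) (P v)^`() * \prod_(i in S :\ v) P i.
Proof.
elim: {S}#|S| {-2}S (erefl #|S|) => [|n IHn] S cS.
  have /eqP -> : S == set0 by rewrite -cards_eq0 cS.
  by rewrite !big_set0 -polyC1 derivC.
have [v vS] : exists v, v \in S by apply/card_gt0P; rewrite cS.
have cSv : #|S :\ v| = n by move: cS; rewrite (cardsD1 v) vS => -[].
rewrite (big_setD1 v vS) derivM IHn // [RHS](big_setD1 v vS) /=; congr (_ + _).
rewrite mulr_sumr; apply: eq_bigr => w; rewrite !inE => /andP[wv wS].
rewrite [in RHS](big_setD1 v) ?inE 1?eq_sym ?wv //=.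
by rewrite !setDDl [[set w] :|: _]setUC; ring.
Qed.

(** * Multi-affine forms and their restrictions to lines *)

Section MultiAffine.
Variables (R : realFieldType) (T : finType).
Implicit Types (a : {set T} -> R) (x y : T -> R) (S U : {set T}) (v : T).

Definition multilin a x : R := \sum_S a S * \prod_(i in S) x i.

Definition homogeneous (k : nat) a := forall S, #|S| != k -> a S = 0.

(* The coefficients of the partial derivative with respect to [v]. *)
Definition partial_coef a v S : R := if v \in S then 0 else a (v |: S).

Lemma eq_multilin a x y : x =1 y -> multilin a x = multilin a y.
Proof.
by move=> eq_xy; apply: eq_bigr => S _; congr (_ * _); apply: eq_bigr.
Qed.

(** Removing [v] is a bijection from the sets containing [v] to those avoiding it. [F] sees both
    sets, so one reindexing serves the partial derivative and its sum of squares. *)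
Lemma reindex_setU1 v (F : {set T} -> {set T} -> R) :
  \sum_(S : {set T} | v \notin S) F S (v |: S) =
  \sum_(S : {set T} | v \in S) F (S :\ v) S.
Proof.
rewrite [RHS](reindex_onto (fun S : {set T} => v |: S) (fun S => S :\ v)) /=; last first.
  by move=> S; apply: setD1K.
have vE S : (v \in v |: S) && ((v |: S) :\ v == S) = (v \notin S).
  rewrite setU11 /=; apply/eqP/idP => [<-|]; first by rewrite setD11.
  exact: setU1K.
rewrite [RHS](eq_bigl _ _ vE); apply: eq_bigr => S vS; by rewrite setU1K.
Qed.

Lemma multilin_partialE a v x :
  multilin (partial_coef a v) x =
    \sum_(S : {set T} | v \in S) a S * \prod_(i in S :\ v) x i.
Proof.
rewrite -(reindex_setU1 v (fun S' S => a S * \prod_(i in S') x i)).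
rewrite /multilin [LHS](bigID (fun S : {set T} => v \in S)) /= big1 ?add0r => [|S vS].
  by apply: eq_bigr => S vS; rewrite /partial_coef (negbTE vS).
by rewrite /partial_coef vS mul0r.
Qed.

Lemma sqr_partial_coef a v :
  \sum_S partial_coef a v S ^+ 2 = \sum_(S : {set T} | v \in S) a S ^+ 2.
Proof.
rewrite -(reindex_setU1 v (fun S' S => a S ^+ 2)).
rewrite [LHS](bigID (fun S : {set T} => v \in S)) /= big1 ?add0r => [|S vS].
  by apply: eq_bigr => S vS; rewrite /partial_coef (negbTE vS).
by rewrite /partial_coef vS expr0n.
Qed.

Lemma homogeneous_partial k a v :
  homogeneous k.+1 a -> homogeneous k (partial_coef a v).
Proof.
move=> ha S nS; rewrite /partial_coef; case: ifP => // vS.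
by apply: ha; rewrite cardsU1 vS.
Qed.

(** On a line every monomial becomes a product of [k] affine polynomials in [t]. The coefficient of
    [t] is the directional derivative at [x] along [y]. *)
Lemma multilin_line k a x y : homogeneous k a ->
  exists p : {poly R}, [/\ (size p <= k.+1)%N,
    forall t, p.[t] = multilin a (fun i => x i + t * y i) &
    p`_1 = \sum_v y v * multilin (partial_coef a v) x].
Proof.
move=> ha; pose L i : {poly R} := (x i)%:P + y i *: 'X.
exists (\sum_S a S *: \prod_(i in S) L i); split.
- apply: (leq_trans (size_sum _ _ _)); apply/bigmax_leqP => S _.
  have [/eqP cS|/ha ->] := boolP (#|S| == k); last by rewrite scale0r size_poly0.
  apply: leq_trans (size_scale_leq _ _) _.
  apply: leq_trans (size_poly_prod_leq _ _) _.
  (* Each factor has size at most 2, so the product has size at most 2k + 1 - k = k + 1. *)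
  rewrite cS leq_subLR addnS ltnS.
  have : (\sum_(i in S) size (L i) <= \sum_(i in S) 2)%N.
    apply: leq_sum => i _; rewrite (leq_trans (size_polyD _ _)) //.
    rewrite geq_max (leq_trans (size_polyC_leq1 _)) //.
    by rewrite (leq_trans (size_scale_leq _ _)) // size_polyX.
  by rewrite sum_nat_const cS muln2 -addnn.
- move=> t; rewrite horner_sum; apply: eq_bigr => S _.
  rewrite hornerZ horner_prod; congr (_ * _); apply: eq_bigr => i _.
  by rewrite /L !hornerE mulrC.
rewrite -[LHS]mulr1n -coef_deriv -horner_coef0 raddf_sum horner_sum.
under [RHS]eq_bigr do rewrite multilin_partialE mulr_sumr.
rewrite [RHS](exchange_big_dep predT) //=; apply: eq_bigr => S _.
rewrite derivZ hornerZ deriv_prod_set horner_sum mulr_sumr.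
apply: eq_bigr => v _.
rewrite /L derivD derivC derivZ derivX !hornerE horner_prod.
under eq_bigr do rewrite !hornerE ?mulr0 ?addr0.
by rewrite /=; ring.
Qed.

(** Let a random [U] contain each [i] independently with probability [x i]; then [w U] is the
    probability of [U]. Being affine in each variable, the form at [x] is the expectation of its
    values at the indicators of [U]. *)
Lemma multilin_unit_cube a (M : R) :
  (forall U, `|multilin a (fun i => (i \in U)%:R)| <= M) ->
  forall x, (forall i, 0 <= x i <= 1) -> `|multilin a x| <= M.
Proof.
move=> aM x x01; pose w U := \prod_i (if i \in U then x i else 1 - x i).
have w0 U : 0 <= w U.
  apply: prodr_ge0 => i _; case: ifP => _; have /andP[] := x01 i => //.
  by rewrite subr_ge0.
have w1 : \sum_U w U = 1.
  rewrite -(bigA_distr _ _ x (fun i => 1 - x i)) /=.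
  by rewrite big1 // => i _; rewrite addrC subrK.
have -> : multilin a x =
    \sum_U w U * multilin a (fun i => (i \in U)%:R).
  under [RHS]eq_bigr do rewrite mulr_sumr.
  rewrite exchange_big; apply: eq_bigr => S _ /=.
  under [RHS]eq_bigr do rewrite mulrCA.
  rewrite -mulr_sumr; congr (_ * _).
  (* The monomial kills the choice [i \notin U] for [i] in [S]; summing over [U] then leaves [x i]
     for [i] in [S] and 1 elsewhere. *)
  have wS U : w U * \prod_(i in S) (i \in U)%:R =
      \prod_i (if i \in U then x i else (1 - x i) * (i \notin S)%:R).
    rewrite [in LHS]big_mkcond -big_split /=; apply: eq_bigr => i _.
    by case: (i \in U); case: (i \in S); rewrite ?mulr1 ?mulr0.
  under [RHS]eq_bigr do rewrite wS.
  rewrite -(bigA_distr _ _ x (fun i => (1 - x i) * (i \notin S)%:R)) /=.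
  rewrite big_mkcond; apply: eq_bigr => i _.
  by case: (i \in S); rewrite /= ?mulr1 ?mulr0 ?addr0 // addrC subrK.
apply: le_trans (ler_norm_sum _ _ _) _.
rewrite -[leRHS]mul1r -[X in X * M]w1 mulr_suml; apply: ler_sum => U _.
by rewrite normrM (ger0_norm (w0 U)) ler_wpM2l.
Qed.

Lemma multilinZ k a x c : homogeneous k a ->
  multilin a (fun i => c * x i) = c ^+ k * multilin a x.
Proof.
move=> ha; rewrite [RHS]mulr_sumr; apply: eq_bigr => S _.
have [/eqP cS|/ha ->] := boolP (#|S| == k); last by rewrite !mul0r mulr0.
by rewrite big_split /= prodr_const cS; ring.
Qed.

End MultiAffine.

(** * Bounds on the cube [-1, 1]^V *)

Lemma multilin_sign_cube (R : realFieldType) (k : nat) :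
  exists2 C : R, 0 <= C &
    forall (T : finType) (a : {set T} -> R) (M : R), homogeneous k a ->
      (forall U : {set T}, `|multilin a (fun i => (i \in U)%:R)| <= M) ->
      forall x, (forall i, `|x i| <= 1) -> `|multilin a x| <= C * M.
Proof.
have [C C0 HC] := poly_coef_bound R k.
exists (k.+1%:R * C) => [|T a M ha aM x x1]; first by rewrite mulr_ge0.
(* With [x = xp - xn], the points [xp + t * xn] stay in the unit cube for [t] in [0, 1], where the
   form is at most [M] in absolute value. This bounds each of the [k.+1] coefficients in [t], and
   [t = -1] gives back [x]. *)
pose xp i := Num.max (x i) 0; pose xn i := Num.max (- x i) 0.
have [p [sz_p pE _]] := multilin_line xp xn ha.
have pM t : 0 <= t <= 1 -> `|p.[t]| <= M.
  move=> /andP[t0 t1]; rewrite pE; apply: multilin_unit_cube => // i.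
  have := x1 i; rewrite ler_norml => /andP[x1i x2i].
  rewrite /xp /xn; case: (leP (x i) 0) => h1; case: (leP (- x i) 0) => h2;
    rewrite ?mulr0 ?addr0 ?add0r.
  - by apply/andP; split; lra.
  - by apply/andP; split; nra.
  - by apply/andP; split; lra.
  - by apply/andP; split; lra.
have -> : multilin a x = p.[-1].
  rewrite pE; apply: eq_multilin => i; rewrite /xp /xn.
  by case: (leP (x i) 0) => h1; case: (leP (- x i) 0) => h2; lra.
rewrite (horner_coef_wide _ sz_p); apply: le_trans (ler_norm_sum _ _ _) _.
have -> : k.+1%:R * C * M = \sum_(i < k.+1) C * M.
  by rewrite sumr_const card_ord -mulrA mulr_natl.
apply: ler_sum => i _; rewrite normrM normrX normrN1 expr1n mulr1.
exact: HC.
Qed.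

(** Along the direction [y] of the signs of the partial derivatives, the linear coefficient in [t]
    is the sum of their absolute values. The segment lies in [-2, 2]^V; scaling it back into the
    cube costs [2 ^+ k] by homogeneity. *)
Lemma sum_partial_bound (R : realFieldType) (k : nat) :
  exists2 C : R, 0 <= C &
    forall (T : finType) (a : {set T} -> R) (M : R), homogeneous k a ->
      (forall U : {set T}, `|multilin a (fun i => (i \in U)%:R)| <= M) ->
      forall x, (forall i, `|x i| <= 1) ->
        \sum_v `|multilin (partial_coef a v) x| <= C * M.
Proof.
have [C C0 HC] := poly_coef_bound R k.
have [C' C'0 HC'] := multilin_sign_cube R k.
exists (C * (2 ^+ k * C')) => [|T a M ha aM x x1].
  by rewrite !mulr_ge0 ?exprn_ge0.
pose y v := Num.sg (multilin (partial_coef a v) x).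
have [p [sz_p pE p1]] := multilin_line x y ha.
have -> : \sum_v `|multilin (partial_coef a v) x| = p`_1.
  by rewrite p1; apply: eq_bigr => v _; rewrite [LHS]normrEsg.
apply: le_trans (ler_norm _) _; rewrite -!mulrA; apply: HC => // t t01.
have -> : p.[t] = 2 ^+ k * multilin a (fun i => 2^-1 * (x i + t * y i)).
  rewrite pE -multilinZ //; apply: eq_multilin => i.
  by rewrite mulrA divff ?mul1r ?pnatr_eq0.
rewrite normrM ger0_norm ?exprn_ge0 // ler_wpM2l ?exprn_ge0 //.
apply: HC' => // i; rewrite normrM ger0_norm ?invr_ge0 //.
have := ler_normD (x i) (t * y i); have := x1 i; rewrite normrM.
have : `|y i| <= 1 by rewrite /y normr_sg; case: (_ != 0).
case/andP: t01 => t0 t1; rewrite (ger0_norm t0).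
by have := normr_ge0 (y i); nra.
Qed.

(** * Averages over random signs and hypercontractivity *)

Section SignAverage.
Variables (R : realFieldType) (T : finType).
Implicit Types (a : {set T} -> R) (x y : T -> R) (F G : (T -> R) -> R).

Definition update y (u : T) (c : R) : T -> R := fun i => if i == u then c else y i.

(* The average of [F] over all choices of signs at the coordinates in [s], the
   other coordinates being those of [x]. *)
Fixpoint sign_avg (s : seq T) F x : R :=
  if s is u :: s' then
    sign_avg s' (fun y => (F (update y u 1) + F (update y u (-1))) / 2) x
  else F x.

(** Setting coordinates to 1 or -1 keeps a point in [-1, 1]^V, so the comparison is asked only
    there, where the bound on the partial derivatives holds. *)
Lemma le_sign_avg s F G x : (forall i, `|x i| <= 1) ->
  (forall y, (forall i, `|y i| <= 1) -> F y <= G y) ->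
  sign_avg s F x <= sign_avg s G x.
Proof.
move=> x1; elim: s F G => [|u s IHs] F G FG /=; first exact: FG.
apply: IHs => y y1; have up c : `|c| <= 1 -> forall i, `|update y u c i| <= 1.
  by move=> c1 i; rewrite /update; case: ifP.
have := FG _ (up 1 _); have := FG _ (up (-1) _).
by rewrite normrN normr1 lexx => /(_ isT) ? /(_ isT) ?; lra.
Qed.

Lemma eq_sign_avg s F G x : F =1 G -> sign_avg s F x = sign_avg s G x.
Proof.
elim: s F G => [|u s IHs] F G FG /=; first exact: FG.
by apply: IHs => y; rewrite !FG.
Qed.

Lemma sign_avg_linear s F G x c d :
  sign_avg s (fun y => c * F y + d * G y) x =
    c * sign_avg s F x + d * sign_avg s G x.
Proof.
elim: s F G => [|u s IHs] F G //=; rewrite -IHs.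
by apply: eq_sign_avg => y; ring.
Qed.

Lemma sign_avg_cst s c x : sign_avg s (fun=> c) x = c.
Proof.
elim: s => //= u s IHs; rewrite -[RHS]IHs; apply: eq_sign_avg => y.
by field.
Qed.

Lemma sign_avg_sum s (I : finType) (F : I -> (T -> R) -> R) x :
  sign_avg s (fun y => \sum_i F i y) x = \sum_i sign_avg s (F i) x.
Proof.
elim: s F => [|u s IHs] F //=; rewrite -IHs.
by apply: eq_sign_avg => y; rewrite -big_split mulr_suml.
Qed.

Definition free_part a (u : T) (S : {set T}) : R := if u \in S then 0 else a S.

Lemma multilin_update a u y c :
  multilin a (update y u c) =
    multilin (free_part a u) y + c * multilin (partial_coef a u) y.
Proof.
rewrite multilin_partialE {1}/multilin (bigID (fun S : {set T} => u \in S)) /=.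
rewrite addrC; congr (_ + _).
  rewrite /multilin [RHS](bigID (fun S : {set T} => u \in S)) /=.
  rewrite [X in _ = X + _]big1 ?add0r => [|S uS]; last first.
    by rewrite /free_part uS mul0r.
  apply: eq_bigr => S uS; rewrite /free_part (negbTE uS); congr (_ * _).
  apply: eq_bigr => i iS; rewrite /update; case: eqP => // iu.
  by rewrite iu (negbTE uS) in iS.
rewrite mulr_sumr; apply: eq_bigr => S uS.
rewrite (big_setD1 u uS) /= {1}/update eqxx mulrCA; congr (_ * (_ * _)).
by apply: eq_bigr => i; rewrite !inE /update => /andP[/negbTE ->].
Qed.

Lemma sqr_update a u :
  \sum_S a S ^+ 2 =
    \sum_S free_part a u S ^+ 2 + \sum_S partial_coef a u S ^+ 2.
Proof.
rewrite sqr_partial_coef (bigID (fun S : {set T} => u \in S)) /= addrC.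
congr (_ + _); rewrite [RHS](bigID (fun S : {set T} => u \in S)) /=.
rewrite [X in _ = X + _]big1 ?add0r => [|S uS]; last first.
  by rewrite /free_part uS expr0n.
by apply: eq_bigr => S uS; rewrite /free_part (negbTE uS).
Qed.

(** Invariant for inductions on [s]: every variable that occurs is averaged, so at the empty list
    only the constant term is left. *)
Definition supported (s : seq T) a := forall S : {set T}, ~~ (S \subset s) -> a S = 0.

Lemma supported_free u s a : supported (u :: s) a -> supported s (free_part a u).
Proof.
move=> sa S nSs; rewrite /free_part; case: ifPn => // uS; apply: sa.
apply: contra nSs => /subsetP Sus; apply/subsetP => i iS.
have := Sus i iS; rewrite inE => /predU1P[iu|//].
by rewrite iu (negbTE uS) in iS.
Qed.

Lemma supported_partial u s a :
  supported (u :: s) a -> supported s (partial_coef a u).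
Proof.
move=> sa S nSs; rewrite /partial_coef; case: ifPn => // uS; apply: sa.
apply: contra nSs => /subsetP Sus; apply/subsetP => i iS.
have := Sus i; rewrite !inE iS orbT => /(_ isT) /predU1P[iu|//].
by rewrite iu (negbTE uS) in iS.
Qed.

Lemma supported_nil a y : supported [::] a ->
  multilin a y = a set0 /\ \sum_S a S ^+ 2 = a set0 ^+ 2.
Proof.
move=> sa; have a0 S : S != set0 -> a S = 0.
  move=> nS; apply: sa; apply: contra nS => /subsetP S0.
  by apply/eqP/setP => i; rewrite inE; apply/negP => /S0.
split; rewrite /multilin (bigD1 set0) //= ?big_set0 ?mulr1 -[RHS]addr0.
  by congr (_ + _); apply: big1 => S /a0 ->; rewrite mul0r.
by congr (_ + _); apply: big1 => S /a0 ->; rewrite expr0n.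
Qed.

Lemma sqr_coef_ge0 a : 0 <= \sum_S a S ^+ 2.
Proof. by apply: sumr_ge0 => S _; apply: sqr_ge0. Qed.

Lemma multilin_eq0 a y : \sum_S a S ^+ 2 = 0 -> multilin a y = 0.
Proof.
move=> /eqP; rewrite psumr_eq0 => [/allP a0|S _]; last exact: sqr_ge0.
rewrite /multilin big1 // => S _.
have := a0 S; rewrite mem_index_enum => /(_ isT) /=.
by rewrite sqrf_eq0 => /eqP ->; rewrite mul0r.
Qed.

(** Parseval's identity: averaging (f + x_u d)^2 over x_u = 1, -1 removes the cross term, and the
    coefficients of f and d together are those of [a]. *)
Lemma sign_avg_sqr s a x : supported s a ->
  sign_avg s (fun y => multilin a y ^+ 2) x = \sum_S a S ^+ 2.
Proof.
elim: s a => [|u s IHs] a sa /=.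
  by have [-> ->] := supported_nil x sa.
rewrite (sqr_update a u) -(IHs _ (supported_free sa)).
rewrite -(IHs _ (supported_partial sa)).
rewrite -[X in X + _]mul1r -[X in _ + X]mul1r -sign_avg_linear.
apply: eq_sign_avg => y; rewrite !multilin_update.
by field.
Qed.

(* Bonami's hypercontractive inequality. *)
Lemma sign_avg_pow4 s k a x : (forall i, `|x i| <= 1) ->
  supported s a -> homogeneous k a ->
  sign_avg s (fun y => multilin a y ^+ 4) x <=
    9 ^+ k * (\sum_S a S ^+ 2) ^+ 2.
Proof.
move=> x1; elim: s k a => [|u s IHs] k a sa ha /=.
  have [-> ->] := supported_nil x sa; rewrite -exprM.
  rewrite ler_peMl ?exprn_even_ge0 // exprn_ege1 //; lra.
have hF : homogeneous k (free_part a u).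
  by move=> S nS; rewrite /free_part; case: ifP => // _; apply: ha.
have sF := supported_free sa; have sD := supported_partial sa.
rewrite (sqr_update a u).
set F := free_part a u in hF sF *; set D := partial_coef a u in sD *.
set A := \sum_S F S ^+ 2; set B := \sum_S D S ^+ 2.
have A0 : 0 <= A := sqr_coef_ge0 F; have B0 : 0 <= B := sqr_coef_ge0 D.
pose f y := multilin F y; pose d y := multilin D y.
(* The odd powers of [d] cancel between (f + d)^4 and (f - d)^4. *)
rewrite (@eq_sign_avg _ _ (fun y =>
   1 * (1 * f y ^+ 4 + 1 * d y ^+ 4) + 6 * (f y ^+ 2 * d y ^+ 2))); last first.
  by move=> y; rewrite !multilin_update -/F -/D -/(f y) -/(d y); field.
rewrite !sign_avg_linear !mul1r.
set p4 := sign_avg s (fun y => f y ^+ 4) x.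
set q4 := sign_avg s (fun y => d y ^+ 4) x.
set pq := sign_avg s (fun y => f y ^+ 2 * d y ^+ 2) x.
have p4A : p4 <= 9 ^+ k * A ^+ 2 := IHs _ _ sF hF.
have [B00|B_neq0] := eqVneq B 0.
  have d0 y : d y = 0 := multilin_eq0 y B00.
  have -> : q4 = 0.
    by rewrite -(sign_avg_cst s 0 x); apply: eq_sign_avg => y; rewrite d0 expr0n.
  have -> : pq = 0.
    rewrite -(sign_avg_cst s 0 x); apply: eq_sign_avg => y.
    by rewrite d0 expr0n mulr0.
  by rewrite B00 mulr0 !addr0.
have Bp : 0 < B by rewrite lt_def B_neq0.
(* A form of degree 0 has zero partial derivatives, against [B != 0]. So the degree is a successor,
   and [d] has degree one less than [f]. *)
case: k => [|k] in ha hF p4A *.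
  case/negP: B_neq0; apply/eqP/big1 => S _; rewrite /D /partial_coef.
  case: ifP => uS; first by rewrite expr0n.
  by rewrite ha ?expr0n // cardsU1 uS.
have q4B : q4 <= 9 ^+ k * B ^+ 2 by apply: IHs sD (homogeneous_partial u ha).
have K0 : 0 <= 9 ^+ k :> R by rewrite exprn_ge0.
move: p4A; rewrite exprS => p4A.
have [A00|A_neq0] := eqVneq A 0.
  have f0 y : f y = 0 := multilin_eq0 y A00.
  have -> : pq = 0.
    rewrite -(sign_avg_cst s 0 x); apply: eq_sign_avg => y.
    by rewrite f0 expr0n mul0r.
  move: p4A; rewrite A00; have : 0 <= 9 ^+ k * B ^+ 2 by rewrite mulr_ge0 ?sqr_ge0.
  nra.
have Ap : 0 < A by rewrite lt_def A_neq0.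
(* AM-GM in the form [6 A B f^2 d^2 <= B^2 f^4 + 9 A^2 d^4]. *)
have pqAB : 6 * A * B * pq <= B ^+ 2 * p4 + 9 * A ^+ 2 * q4.
  rewrite -sign_avg_linear -[leLHS]addr0 -[X in _ + X](mul0r pq) -sign_avg_linear.
  apply: le_sign_avg => // y _.
  have := sqr_ge0 (B * f y ^+ 2 - 3 * A * d y ^+ 2); nra.
(* The lower degree of [d] saves a factor 9 in [q4B], which offsets the 9 of AM-GM: both terms are
   at most [9 * 9 ^+ k * A ^+ 2 * B ^+ 2]. *)
have {}pqAB : 6 * A * B * pq <= A * B * (2 * (9 * 9 ^+ k) * (A * B)).
  apply: le_trans pqAB _.
  have /(ler_wpM2l (sqr_ge0 B)) := p4A; have /(ler_wpM2l (sqr_ge0 A)) := q4B.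
  nra.
have ABp : 0 < A * B by rewrite mulr_gt0.
have : 6 * pq <= 2 * (9 * 9 ^+ k) * (A * B).
  by rewrite -(ler_pM2l ABp); apply: le_trans pqAB; lra.
have : 0 <= 9 ^+ k * B ^+ 2 by rewrite mulr_ge0 ?sqr_ge0.
nra.
Qed.

End SignAverage.

(** A bounded fourth moment keeps the second moment from concentrating on few sign patterns, so the
    two together bound the first moment from below. *)
Lemma sign_avg_norm (R : rcfType) (T : finType) (k : nat) (a : {set T} -> R) x :
  (forall i, `|x i| <= 1) -> homogeneous k a ->
  3 / 4 / 3 ^+ k * Num.sqrt (\sum_S a S ^+ 2) <=
    sign_avg (enum T) (fun y => `|multilin a y|) x.
Proof.
move=> x1 ha; set Q := \sum_S _; set A := sign_avg _ _ _.
have A0 : 0 <= A.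
  by rewrite -(sign_avg_cst (enum T) 0 x); apply: le_sign_avg.
have [Q0|Q_neq0] := eqVneq Q 0; first by rewrite Q0 sqrtr0 mulr0.
have Qp : 0 < Q by rewrite lt_def Q_neq0 sqr_coef_ge0.
have sa : supported (enum T) a.
  by move=> S /negP[]; apply/subsetP => i _; rewrite mem_enum.
have m2 := sign_avg_sqr x sa; have m4 := sign_avg_pow4 x1 sa ha.
rewrite -/Q in m2 m4; set w := Num.sqrt Q; have wp : 0 < w by rewrite sqrtr_gt0.
have w2 : w ^+ 2 = Q by rewrite sqr_sqrtr ?ltW.
set h : R := 3 ^+ k; have hp : 0 < h by rewrite exprn_gt0.
have h2 : 9 ^+ k = h ^+ 2 by rewrite -exprM mulnC exprM; congr (_ ^+ _); ring.
(* With this scale the two terms of [key] are w / h and w / (4 h), whence the constant 3 / 4. *)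
pose M := h * w; have Mp : 0 < M by rewrite mulr_gt0.
(* Integrate [t >= t^2 - t^4 / 4], valid for [t >= 0], at [t = |multilin a y| / M]. *)
have key : M^-1 * Q + - (4 * M ^+ 3)^-1 * (h ^+ 2 * Q ^+ 2) <= A.
  apply: le_trans (_ : M^-1 * Q + - (4 * M ^+ 3)^-1 *
      sign_avg (enum T) (fun y => multilin a y ^+ 4) x <= _).
    rewrite lerD2l !mulNr lerN2 -h2 ler_wpM2l // invr_ge0 mulr_ge0 //.
    by rewrite exprn_ge0 // ltW.
  rewrite -m2 -sign_avg_linear; apply: le_sign_avg => // y _.
  set g := `|_|; have g0 : 0 <= g by apply: normr_ge0.
  have -> : multilin a y ^+ 2 = g ^+ 2 by rewrite real_normK ?num_real.
  have -> : multilin a y ^+ 4 = g ^+ 4.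
    by rewrite -[4%N]/(2 * 2)%N !exprM real_normK ?num_real.
  pose t := g / M; have t0 : 0 <= t by rewrite divr_ge0 // ltW.
  have -> : g = t * M by rewrite divfK ?gt_eqF.
  have -> : M^-1 * (t * M) ^+ 2 + - (4 * M ^+ 3)^-1 * (t * M) ^+ 4 =
      M * (t ^+ 2 - t ^+ 4 / 4) by field; rewrite gt_eqF.
  rewrite [t * M]mulrC ler_pM2l //.
  (* The point 6 / 5 approximates the minimiser 2 / sqrt 3 of this cubic on [t >= 0]. *)
  have : 0 <= 1 - t + t ^+ 3 / 4.
    have := mulr_ge0 (sqr_ge0 (t - 6 / 5)) t0.
    by have := sqr_ge0 (t - 6 / 5); nra.
  by move=> /(mulr_ge0 t0); nra.
apply: le_trans key; rewrite -w2 /M le_eqVlt; apply/orP; left; apply/eqP.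
by field; rewrite !gt_eqF.
Qed.

(** * Edge weights of a hypergraph *)

Lemma card_draws_in (T : finType) (k : nat) (v : T) :
  #|[set S : {set T} | v \in S & #|S| == k.+1]| = 'C(#|T|.-1, k).
Proof.
set n := #|T|.-1; have cT : #|T| = n.+1.
  by rewrite prednK //; apply/card_gt0P; exists v.
(* In Pascal's rule, the sets avoiding [v] account for the term ['C(n, k.+1)]. *)
have := card_draws T k.+1; rewrite cT binS.
rewrite -(cardsID [set S : {set T} | v \in S]) addnC.
have -> : #|[set S : {set T} | #|S| == k.+1] :\: [set S : {set T} | v \in S]| = 'C(n, k.+1).
  rewrite -[n]/(#|T|.-1) -(cardsC1 v) -cards_draws; apply: eq_card => S.
  by rewrite !inE; congr (_ && _); rewrite -[in RHS](setCK S) setCS sub1set inE.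
by move=> /addnI <-; apply: eq_card => S; rewrite !inE andbC.
Qed.

Section Hypergraph.
Variables (R : realType) (T : finType) (r : nat) (E : {set {set T}}).

Local Notation p := (density R r E).

Definition edge_weight (S : {set T}) : R :=
  if #|S| == r then (S \in E)%:R - p else 0.

Lemma homogeneous_edge_weight : homogeneous r edge_weight.
Proof. by move=> S; rewrite /edge_weight => /negbTE ->. Qed.

(** As an indicator equals its square, both the weight and its square are affine in the indicator of
    [E]; this covers the two cases. *)
Lemma sum_edge_weight (P : pred {set T}) (a b : R) : uniform r E ->
  \sum_(S | P S && (#|S| == r)) (a * (S \in E)%:R + b) =
    a * #|[set S in E | P S]|%:R + b * #|[set S | P S & #|S| == r]|%:R.
Proof.
move=> unifE; rewrite big_split /= -mulr_sumr; congr (_ * _ + _).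
  rewrite -natr_sum -big_mkcondr sum1dep_card; congr (_%:R).
  apply: eq_card => S; rewrite !inE andbC.
  have [SE|//] := boolP (S \in E); rewrite /= (forall_inP unifE S SE) andbT //.
by rewrite sumr_const mulr_natr; congr (_ *+ _); apply: eq_card => S; rewrite !inE.
Qed.

Lemma sum_edge_weight1 (P : pred {set T}) : uniform r E ->
  \sum_(S | P S) edge_weight S =
    #|[set S in E | P S]|%:R - p * #|[set S | P S & #|S| == r]|%:R.
Proof.
move=> unifE; rewrite -mulNr -[X in X + _]mul1r -sum_edge_weight // big_mkcondr /=.
by apply: eq_bigr => S _; rewrite mul1r.
Qed.

Lemma sum_edge_weight2 (P : pred {set T}) : uniform r E ->
  \sum_(S | P S) edge_weight S ^+ 2 = (1 - 2 * p) * #|[set S in E | P S]|%:R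
    + p ^+ 2 * #|[set S | P S & #|S| == r]|%:R.
Proof.
move=> unifE; rewrite -sum_edge_weight // big_mkcondr /=; apply: eq_bigr => S _.
rewrite /edge_weight; case: eqP => _; last by rewrite expr0n.
by case: (S \in E) => /=; ring.
Qed.

(** At the indicator of [U] exactly the monomials of subsets of [U] survive. *)
Lemma multilin_edge_weight (U : {set T}) : uniform r E ->
  multilin edge_weight (fun i => (i \in U)%:R) = discU R r E U.
Proof.
move=> unifE; rewrite /discU -cards_draws /e_in.
rewrite -(sum_edge_weight1 (fun S => S \subset U)) //.
rewrite /multilin [RHS]big_mkcond /=; apply: eq_bigr => S _.
have [/subsetP SU|/subsetPn[i iS iU]] := boolP (S \subset U).
  by rewrite big1 ?mulr1 // => i /SU ->.
by rewrite (bigD1 i) //= (negbTE iU) mul0r mulr0.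
Qed.

Lemma discU_le_disc (U : {set T}) : `|discU R r E U| <= disc R r E.
Proof. exact: (le_bigmax _ (fun U => `|discU R r E U|)). Qed.

Lemma disc_ge0 : 0 <= disc R r E.
Proof. exact: le_trans (normr_ge0 _) (discU_le_disc set0). Qed.

End Hypergraph.

(** * Summation over the vertices *)

Theorem theorem1p3 (R : realType) (r : nat) (hr : (2 <= r)%N) :
  exists c : R, 0 < c /\
    forall (T : finType) (E : {set {set T}}),
      uniform r E ->
      1 <= avg_degree R r E ->
      avg_degree R r E <= 2^-1 * ('C(#|T|.-1, r.-1))%:R ->
      c * Num.sqrt (avg_degree R r E) * (#|T|)%:R <= disc R r E.
Proof.
case: r hr => [//|k] _; have [C C0 HC] := sum_partial_bound R k.+1.
(* Half the constant of [sign_avg_norm] in degree [k], the degree of the partial derivatives. *)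
pose c0 : R := 3 / 8 / 3 ^+ k.
have c0p : 0 < c0 by rewrite !divr_gt0 ?exprn_gt0 // ltr0n.
have C1 : 0 < 2 * C + 1 by lra.
(* Two sums over the vertices, each at most [C] times the discrepancy, give [2 * C]; adding 1 keeps
   the denominator positive even if [C] is 0. *)
exists (c0 / (2 * C + 1)); split=> [|T E unifE]; first exact: divr_gt0.
set d := avg_degree R k.+1 E; rewrite [k.+1.-1]/=; set N := 'C(_, k) => d1 dN.
(* On an empty vertex set, division by zero would make [d] equal to 0. *)
have nT : #|T| != 0%N.
  by apply: contraTneq d1 => n0; rewrite /d /avg_degree n0 invr0 mulr0 ler10.
have N0 : 0 < N%:R :> R by lra.
have nCr : 'C(#|T|, k.+1) != 0%N.
  apply: contraTneq N0 => C00; have := mul_bin_diag #|T| k.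
  rewrite C00 muln0 => /eqP; rewrite muln_eq0 (negbTE nT) /= => /eqP.
  by rewrite -/N => ->; rewrite ltxx.
pose p := density R k.+1 E.
have pN : p * N%:R = d.
  have /(congr1 (fun m => m%:R : R)) := mul_bin_diag #|T| k.
  rewrite !natrM -/N => binE.
  rewrite /d /avg_degree /p /density natrM.
  have n0 : #|T|%:R != 0 :> R by rewrite pnatr_eq0.
  have b0 : 'C(#|T|, k.+1)%:R != 0 :> R by rewrite pnatr_eq0.
  apply: (mulfI n0); apply: (mulfI b0).
  transitivity (#|E|%:R * (#|T|%:R * N%:R) : R); first by field.
  by rewrite binE; field.
(* This makes the factor [1 - 2 * p] in [Q] nonnegative. *)
have p_half : p <= 2^-1 by rewrite -(ler_pM2r N0) pN.
have p0 : 0 <= p by rewrite divr_ge0.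
pose w := edge_weight R k.+1 E; have hw : homogeneous k.+1 w.
  exact: homogeneous_edge_weight.
have {}HC := HC T w (disc R k.+1 E) hw _.
have {}HC x : (forall i, `|x i| <= 1) ->
    \sum_v `|multilin (partial_coef w v) x| <= C * disc R k.+1 E.
  by apply: HC => U; rewrite multilin_edge_weight //; apply: discU_le_disc.
pose deg v : R := #|[set S in E | v \in S]|%:R.
(* At the all-ones point the partial derivative at [v] sums the weights of all [k.+1]-sets through
   [v], giving [deg v - p * N]. *)
have degE : \sum_v `|deg v - d| <= C * disc R k.+1 E.
  apply: le_trans (HC (fun=> 1) _) => [|i]; last by rewrite normr1.
  apply: ler_sum => v _; rewrite multilin_partialE.
  under eq_bigr do rewrite big1_eq mulr1.
  rewrite (sum_edge_weight1 _ (fun S : {set T} => v \in S) unifE).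
  by rewrite card_draws_in -/N pN.
pose Q v := (1 - 2 * p) * deg v + p * d.
(* The bound [HC] holds at every sign vector, hence also on average; the average is then taken
   vertex by vertex. *)
have QE : \sum_v 3 / 4 / 3 ^+ k * Num.sqrt (Q v) <= C * disc R k.+1 E.
  have one1 (i : T) : `|1 : R| <= 1 by rewrite normr1.
  rewrite -[leRHS](sign_avg_cst (enum T) _ (fun=> 1)).
  apply: le_trans (le_sign_avg (enum T) one1 HC).
  rewrite sign_avg_sum; apply: ler_sum => v _.
  apply: le_trans (sign_avg_norm one1 (homogeneous_partial v hw)).
  rewrite sqr_partial_coef (sum_edge_weight2 _ (fun S : {set T} => v \in S) unifE).
  by rewrite card_draws_in -/N -/p (_ : p ^+ 2 * N%:R = p * d) // expr2 -mulrA pN.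
have d0 : 0 <= d by lra.
have sd0 := sqrtr_ge0 d; have sd2 := sqr_sqrtr d0.
(* So [sqrt d <= d], and a degree deviation of [d / 2] dominates [c0 * sqrt d]. *)
have sd1 : 1 <= Num.sqrt d by rewrite -sqrtr1 ler_wsqrtr.
have h1 : 1 <= 3 ^+ k :> R by rewrite exprn_ege1 //; lra.
have c0s : c0 <= 3 / 8.
  by rewrite /c0 ler_pdivrMr ?exprn_gt0 //; lra.
(* Either the degree of [v] deviates from [d] by at least [d / 2], or the
   variance [Q v] is at least [d / 2]. *)
have vertex v : c0 * Num.sqrt d <= `|deg v - d| + 3 / 4 / 3 ^+ k * Num.sqrt (Q v).
  have [small|large] := leP (deg v) (d / 2).
    rewrite -[leLHS]addr0 lerD //; last first.
      by rewrite mulr_ge0 ?sqrtr_ge0 // !divr_ge0 ?exprn_ge0.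
    rewrite ler0_norm ?subr_le0; last by lra.
    have := ler_wpM2r sd0 c0s; nra.
  rewrite -[leLHS]add0r lerD //.
  have -> : 3 / 4 / 3 ^+ k = c0 * 2 by rewrite /c0; lra.
  rewrite -[leRHS]mulrA ler_pM2l //.
  (* The factor 2 between [c0] and the constant of [sign_avg_norm] is absorbed here, leaving
     [d / 4 <= Q v] to check. *)
  have -> : Num.sqrt d = 2 * Num.sqrt (d / 4).
    rewrite -[in LHS](_ : 2 ^+ 2 * (d / 4) = d); last by field.
    by rewrite sqrtrM ?sqr_ge0 // sqrtr_sqr ger0_norm.
  rewrite ler_pM2l // ler_wsqrtr // /Q; nra.
have : \sum_(v : T) c0 * Num.sqrt d <= 2 * C * disc R k.+1 E.
  apply: le_trans (ler_sum _ (fun v _ => vertex v)) _.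
  by rewrite big_split /=; lra.
rewrite sumr_const -[leLHS]mulr_natr => fin.
rewrite [c0 / _ * _]mulrAC [leLHS]mulrAC ler_pdivrMr //.
by have := disc_ge0 R k.+1 E; lra.
Qed.
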